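(* Let $\mathfrak{H},\mathcal{K}$ be complex Hilbert spaces, $\omega\in\mathfrak{H}$ a distinguished unit vector, and let $\mathcal{E}$, $\pi$, $A^\ast_\eta$, $A_{\eta,n}$, $\phi$, $\psi$ be as defined in the context. Let $\eta$ be a unit vector of $\mathcal{K}$, let $d\in\pi(\mathcal{L}(\mathfrak{H}))$, and let $f(z)=\sum_{k=0}^{M}f_kz^k$ be a polynomial with complex coefficients such that $\psi(d)\neq0$ and $f_0\neq0$. Put $A_{\eta,f^{\otimes}}=\sum_{k=0}^{M}f_kA_{\eta,k}$ and $$\beta=d+dA^\ast_\eta+A_{\eta,f^{\otimes}}\in\mathcal{L}(\mathcal{E}).$$ Then ${}^cT_\beta(z)=f(z)$, where ${}^cT_\beta$ is taken with respect to the pair $(\phi,\psi)$.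
   Context: $\mathcal{L}(V)$ denotes the bounded linear operators on a Hilbert space $V$; inner products are linear in the first variable. Space: $\mathcal{T}^0(\mathcal{K})=\bigoplus_{n\ge1}\mathcal{K}^{\otimes n}$, $\mathcal{T}(\mathcal{K})=\mathbb{C}\omega_1\oplus\mathcal{T}^0(\mathcal{K})$ with $\|\omega_1\|=1$; $\mathcal{E}=\mathfrak{H}\oplus(\mathfrak{H}\otimes\mathcal{T}(\mathcal{K}))$; $\mathfrak{H}^0=\mathfrak{H}\ominus\mathbb{C}\omega$; $\Omega=\omega\otimes\omega_1\in\mathfrak{H}\otimes\mathcal{T}(\mathcal{K})$. Functionals on $\mathcal{L}(\mathcal{E})$: $\phi(T)=\langle T\Omega,\Omega\rangle$ and $\psi(T)=\langle T\omega,\omega\rangle$, where in the latter $\omega$ is viewed in the first direct summand $\mathfrak{H}$ of $\mathcal{E}$. Embedding $\pi:\mathcal{L}(\mathfrak{H})\to\mathcal{L}(\mathcal{E})$: $\pi(a)$ acts as $a$ on the summand $\mathfrak{H}$, as $a\otimes\mathrm{Id}$ on $\mathfrak{H}\otimes\mathcal{T}^0(\mathcal{K})$, and as $0$ on $\mathfrak{H}\otimes\mathbb{C}\omega_1$. For nonzero $\eta\in\mathcal{K}$, $A^\ast_\eta\in\mathcal{L}(\mathcal{E})$ is given by $A^\ast_\eta\zeta=0$ for $\zeta\in\mathfrak{H}\oplus(\mathfrak{H}^0\otimes\mathcal{T}(\mathcal{K}))$, $A^\ast_\eta(\omega\otimes\omega_1)=\omega\otimes\eta$, $A^\ast_\eta(\omega\otimes\zeta)=\omega\otimes(\eta\otimes\zeta)$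 for $\zeta\in\mathcal{T}^0(\mathcal{K})$. $A_{\eta,0}$ is the orthogonal projection onto $\mathbb{C}\Omega$; for $n\ge1$, $A_{\eta,n}(\omega\otimes\eta^{\otimes n})=\Omega$ and $A_{\eta,n}\zeta=0$ for $\zeta\perp\omega\otimes\eta^{\otimes n}$. ${}^cT$-transform: for $X\in\mathcal{L}(\mathcal{E})$ let $m_X(z)=\sum_{k\ge1}\psi(X^k)z^k$ and $M_X(z)=\sum_{k\ge1}\phi(X^k)z^k$ (formal power series). If $\psi(X)\neq0$, ${}^cT_X$ is the formal power series determined by $${}^cT_X(m_X(z))\cdot(1+M_X(z))=\tfrac1z M_X(z).$$ *)

(* Defs.v *)
From HB Require Import structures.
From mathcomp Require Import all_boot all_order all_algebra.
From mathcomp Require Import all_classical all_reals all_analysis.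
From mathcomp Require Import sesquilinear complex.

Set Implicit Arguments.
Unset Strict Implicit.
Unset Printing Implicit Defensive.

Import Order.TTheory GRing.Theory Num.Theory.
Import numFieldNormedType.Exports.

Local Open Scope classical_set_scope.
Local Open Scope ring_scope.

(* [inner] is linear in its first variable and conjugate-linear in its second
   one. The norm of a normed module over [R[i]] has values in [R[i]]. *)
HB.mixin Record NormedModule_isInnerProduct (R : realType) (V : Type)
    of NormedModule R[i] V := {
  inner : {dot V for (@Num.conj R[i])} ;
  inner_norm : forall x : V, inner x x = `|x| ^+ 2
}.

#[short(type="hilbertType")]
HB.structure Definition Hilbert (R : realType) :=
  {V of CompleteNormedModule R[i] V & NormedModule_isInnerProduct R V}.

Section hilbert_spaces.
Context {R : realType}.
Implicit Types H K V W : hilbertType R.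

Definition bounded_operator V W (T : V -> W) : Prop :=
  linear T /\ exists C : R[i], forall x, `|T x| <= C * `|x|.

Definition linear_isometry V W (u : V -> W) : Prop :=
  linear u /\ forall x y, inner (u x) (u y) = inner x y.

Definition linear_span V (A : set V) : set V :=
  [set v | exists n (c : 'I_n -> R[i]) (a : 'I_n -> V),
    (forall i, A (a i)) /\ v = \sum_i c i *: a i].

Definition orthogonal_projection V (D : set V) (P : V -> V) : Prop :=
  forall x, D (P x) /\ forall y, D y -> inner (x - P x) y = 0.

(* [W], with [t x y] for the elementary tensor of [x] and [y], is a completion
   of the algebraic tensor product of [H] and [K]; this determines [(W, t)] up
   to a unique unitary. *)
Definition hilbert_tensor H K W (t : H -> K -> W) : Prop :=
  [/\ forall y, linear (t^~ y),
      forall x, linear (t x),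
      forall x x' y y', inner (t x y) (t x' y') = inner x x' * inner y y'
    & dense (linear_span [set w | exists x y, w = t x y])].

Definition hilbert_sum2 V1 V2 W (u1 : V1 -> W) (u2 : V2 -> W) : Prop :=
  [/\ linear_isometry u1, linear_isometry u2,
      forall x y, inner (u1 x) (u2 y) = 0
    & forall w, exists x y, w = u1 x + u2 y].

Definition hilbert_sum (V : nat -> hilbertType R) W
    (u : forall n, V n -> W) : Prop :=
  [/\ forall n, linear_isometry (u n),
      forall m n x y, m != n -> inner (u m x) (u n y) = 0
    & dense (linear_span [set w | exists n x, w = u n x])].

End hilbert_spaces.

(* The space E = H (+) (H (x) T(K)) with its constituents. *)
Record fock_model (R : realType) (H K : hilbertType R) := FockModel {
  (* [Kpow n] is the (n+1)-st tensor power of [K]; [Kpow1] identifies [K] with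
     its first tensor power *)
  Kpow : nat -> hilbertType R ;
  Kpow1 : K -> Kpow 0 ;
  Kpow_tensor : forall n, K -> Kpow n -> Kpow n.+1 ;
  T0 : hilbertType R ;
  T0_in : forall n, Kpow n -> T0 ;
  TK : hilbertType R ;
  omega1 : TK ;
  T_in : T0 -> TK ;
  HT : hilbertType R ;
  HT_tensor : H -> TK -> HT ;
  E : hilbertType R ;
  E_in1 : H -> E ;
  E_in2 : HT -> E ;
  Kpow1_isom : linear_isometry Kpow1 /\ set_surj setT setT Kpow1 ;
  Kpow_tensorP : forall n, hilbert_tensor (@Kpow_tensor n) ;
  T0_sum : hilbert_sum T0_in ;
  omega1_unit : `|omega1| = 1 ;
  T_in_isom : linear_isometry T_in ;
  omega1_T_in : forall z, inner omega1 (T_in z) = 0 ;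
  T_sum : forall t, exists (c : R[i]) (z : T0), t = c *: omega1 + T_in z ;
  HT_tensorP : hilbert_tensor HT_tensor ;
  E_sum : hilbert_sum2 E_in1 E_in2
}.
Arguments E {R H K} f.

Section operators.
Context {R : realType} {H K : hilbertType R} (S : fock_model H K).
Variable omega : H.

(* [tens h t] is the elementary tensor of [h] and [t] inside E, and
   [fock z] is [z] in K^{(x)(n+1)} viewed in T(K) *)
Definition tens (h : H) (t : TK S) : E S := E_in2 (HT_tensor h t).
Definition fock n (z : Kpow S n) : TK S := T_in (T0_in z).

Definition Omega : E S := tens omega (omega1 S).

Definition phi (X : E S -> E S) : R[i] := inner (X Omega) Omega.

Definition psi (X : E S -> E S) : R[i] :=
  inner (X (E_in1 S omega)) (E_in1 S omega).

(* Each of the three predicates below prescribes a bounded operator on a total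
   subset of E, hence determines it. *)

Definition is_pi (a : H -> H) (p : E S -> E S) : Prop :=
  [/\ bounded_operator p,
      forall h, p (E_in1 S h) = E_in1 S (a h),
      forall h (z : T0 S), p (tens h (T_in z)) = tens (a h) (T_in z)
    & forall h, p (tens h (omega1 S)) = 0].

(* The left tensoring by [eta] from T^0(K) to itself is given on each summand
   K^{(x)(n+1)} of T^0(K). *)
Definition is_Astar (eta : K) (T : E S -> E S) : Prop :=
  [/\ bounded_operator T,
      forall h, T (E_in1 S h) = 0,
      forall h t, inner h omega = 0 -> T (tens h t) = 0,
      T (tens omega (omega1 S)) = tens omega (fock (Kpow1 S eta))
    & forall n (z : Kpow S n),
        T (tens omega (fock z)) = tens omega (fock (Kpow_tensor eta z))].

(* [tpow eta n] is the (n+1)-st tensor power of [eta] *)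
Fixpoint tpow (eta : K) n : Kpow S n :=
  if n is m.+1 then Kpow_tensor eta (tpow eta m) else Kpow1 S eta.

Definition is_A (eta : K) (n : nat) (T : E S -> E S) : Prop :=
  bounded_operator T /\
  if n is m.+1 then
    T (tens omega (fock (tpow eta m))) = Omega /\
    forall x, inner x (tens omega (fock (tpow eta m))) = 0 -> T x = 0
  else orthogonal_projection [set x | exists c : R[i], x = c *: Omega] T.

End operators.

(* A formal power series is the sequence of its coefficients. *)
Section power_series.
Context {C : fieldType}.
Implicit Types a b : nat -> C.

Definition fps_one : nat -> C := fun n => (n == 0%N)%:R.

Definition fps_add a b : nat -> C := fun n => a n + b n.

Definition fps_mul a b : nat -> C :=
  fun n => \sum_(i < n.+1) a i * b (n - i)%N.

Definition fps_exp a k : nat -> C := iter k (fps_mul a) fps_one.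

(* The series a(b(z)), for [b] without constant term: b^k then has no
   coefficient of degree less than k, whence the bound on the sum. *)
Definition fps_comp a b : nat -> C :=
  fun n => \sum_(k < n.+1) a k * fps_exp b k n.

(* a(z) / z, for [a] without constant term *)
Definition fps_divz a : nat -> C := fun n => a n.+1.

Lemma triangular_solvable (L : nat -> nat -> C) (s : nat -> C) :
  (forall n, L n n != 0) ->
  exists t : nat -> C, forall n, \sum_(k < n.+1) t k * L n k = s n.
Proof.
move=> L0.
pose F := fix F n : seq C := if n is m.+1 then
  rcons (F m) ((s m - \sum_(k < m) (F m)`_k * L m k) / L m m) else [::].
have sF n : size (F n) = n by elim: n => //= n IH; rewrite size_rcons IH.
have FF k n : (k < n)%N -> (F n)`_k = (F k.+1)`_k.
  elim: n => // n IH; rewrite ltnS leq_eqVlt => /predU1P[->//|kn].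
  by rewrite [F n.+1]/= nth_rcons sF kn IH.
exists (fun k => (F k.+1)`_k) => n.
rewrite big_ord_recr /= nth_rcons sF ltnn eqxx divfK//.
rewrite (eq_bigr (fun k : 'I_n => (F n)`_k * L n k)).
  by rewrite addrC subrK.
by move=> k _; congr (_ * _); exact/esym/(FF k n (ltn_ord k)).
Qed.

Lemma triangular_inj (L : nat -> nat -> C) (t t' : nat -> C) :
  (forall n, L n n != 0) ->
  (forall n, \sum_(k < n.+1) t k * L n k = \sum_(k < n.+1) t' k * L n k) ->
  t = t'.
Proof.
move=> L0 tt'; apply/funext => n.
elim/ltn_ind: n => n IH; have := tt' n; rewrite !big_ord_recr /=.
rewrite (eq_bigr (fun k : 'I_n => t' k * L n k)); last by move=> k _; rewrite IH.
by move/addrI/(mulIf (L0 n)).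
Qed.

Lemma fps_exp_low b k n : b 0%N = 0 -> (n < k)%N -> fps_exp b k n = 0.
Proof.
move=> b0; elim: k n => // k IH n nk.
rewrite /fps_exp iterS -/(fps_exp b k) /fps_mul big1// => -[[|i] /= lin] _.
  by rewrite b0 mul0r.
case: n nk lin => [|n] nk // _.
by rewrite IH ?mulr0// subSS (leq_ltn_trans (leq_subr _ _)).
Qed.

Lemma fps_exp_diag b k : b 0%N = 0 -> fps_exp b k k = b 1%N ^+ k.
Proof.
move=> b0; elim: k => [|k IH]; first by rewrite /fps_exp /= /fps_one eqxx.
rewrite /fps_exp iterS -/(fps_exp b k) /fps_mul 2!big_ord_recl /= b0 mul0r add0r.
rewrite /bump /= addn0 subSS subn0 IH -exprS big1 ?addr0// => i _.
rewrite fps_exp_low ?mulr0// /bump /= add1n subSS.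
by rewrite ltn_subrL/= (leq_ltn_trans (leq0n i)).
Qed.

End power_series.

Section cT_transform.
Context {R : realType} {V : Type}.
Variables phi psi : (V -> V) -> R[i].

Definition moment_series (chi : (V -> V) -> R[i]) (X : V -> V) : nat -> R[i] :=
  fun k => if k == 0%N then 0 else chi (iter k X).

Definition cT_equation (X : V -> V) (t : nat -> R[i]) : Prop :=
  fps_mul (fps_comp t (moment_series psi X))
          (fps_add fps_one (moment_series phi X))
  = fps_divz (moment_series phi X).

(* The solution exists and is unique when [psi X] is nonzero: see [cTP] and
   [cT_unique]. *)
Definition cT (X : V -> V) : nat -> R[i] :=
  xget (fun=> 0) [set t | cT_equation X t].

Let N X := fps_add (@fps_one R[i]) (moment_series phi X).

Let N0 X n : N X (n - n)%N != 0.
Proof. by rewrite subnn /N /fps_add /fps_one addr0 oner_neq0. Qed.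

Let L0 X n : psi X != 0 -> fps_exp (moment_series psi X) n n != 0.
Proof. by move=> X0; rewrite fps_exp_diag// expf_neq0. Qed.

Lemma cT_exists X : psi X != 0 -> exists t, cT_equation X t.
Proof.
move=> X0.
have [g gE] := @triangular_solvable _ (fun n k => N X (n - k)%N)
  (fps_divz (moment_series phi X)) (N0 X).
have [t tE] := @triangular_solvable _
  (fun n k => fps_exp (moment_series psi X) k n) g (fun n => L0 n X0).
exists t; apply/funext => n; rewrite -gE.
by apply: eq_bigr => i _; rewrite -tE.
Qed.

Lemma cTP X : psi X != 0 -> cT_equation X (cT X).
Proof. by move=> /cT_exists[t tE]; exact: (xgetPex _ (ex_intro _ t tE)). Qed.

Lemma cT_unique X t : psi X != 0 -> cT_equation X t -> t = cT X.
Proof.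
move=> X0 tE.
have comp_eq : fps_comp t (moment_series psi X) =
    fps_comp (cT X) (moment_series psi X).
  apply: (@triangular_inj _ (fun n k => N X (n - k)%N)); first exact: N0.
  by move=> n; exact: (congr1 (@^~ n) (eq_trans tE (esym (cTP X0)))).
apply: (@triangular_inj _ (fun n k => fps_exp (moment_series psi X) k n)).
  by move=> n; exact: L0.
by move=> n; exact: (congr1 (@^~ n) comp_eq).
Qed.

End cT_transform.

(* Main.v *)
(** Idea: on the summand [H] the operator [beta] acts as [a], so the [psi]-moments
    of [beta] are m_k = <a^k omega, omega>. In H (x) T(K) write
      beta^n Omega = c_n Omega + sum_j h_{n,j} (x) eta^(x)(j+1),
    so that c_n is the n-th coefficient of 1 + M_beta. The action of [beta] on these
    vectors gives h_{n+1,j} = a h_{n,j} + s_{j,n} (a omega), where s_{0,n} = c_n and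
    s_{j+1,n} = <h_{n,j}, omega>. Solving this recursion, the series s_{j+1} is
    m s_j, hence s_j = m^j (1 + M), and reading off the Omega-component
      c_{n+1} = sum_j f_j s_{j,n}
    is exactly the coefficient of z^n in M / z = f(m) (1 + M). *)
Require Import Defs.
From HB Require Import structures.
From mathcomp Require Import all_boot all_order all_algebra.
From mathcomp Require Import all_classical all_reals all_analysis.
From mathcomp Require Import sesquilinear complex.

Set Implicit Arguments.
Unset Strict Implicit.
Unset Printing Implicit Defensive.

Import Order.TTheory GRing.Theory Num.Theory.
Import numFieldNormedType.Exports.

Local Open Scope ring_scope.

(** * Cauchy products, powers and composition of formal power series *)

Section power_series.
Context {C : fieldType}.
Implicit Types a b c : nat -> C.

(** Coefficients up to degree n of a product depend only on those of the factors up to n, so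
    truncation to [{poly C}] carries associativity over. *)
Lemma fps_mulA a b c : fps_mul a (fps_mul b c) = fps_mul (fps_mul a b) c.
Proof.
apply/funext => n.
pose P u : {poly C} := \poly_(i < n.+1) u i.
have PE u i : (i < n.+1)%N -> (P u)`_i = u i by move=> ni; rewrite coef_poly ni.
have PM u v i : (i < n.+1)%N -> fps_mul u v i = (P u * P v)`_i.
  move=> ni; rewrite coefM; apply: eq_bigr => j _.
  by rewrite !PE// ?(leq_ltn_trans (leq_subr _ _) ni)// (leq_trans (ltn_ord j)).
transitivity ((P a * P b * P c)`_n).
  rewrite -mulrA coefM; apply: eq_bigr => j _.
  by rewrite PE// PM// ltnS leq_subr.
rewrite coefM; apply: eq_bigr => j _.
by rewrite PM// PE// ltnS leq_subr.
Qed.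

Lemma fps_mulC a b : fps_mul a b = fps_mul b a.
Proof.
apply/funext => n; rewrite /fps_mul (reindex_inj rev_ord_inj) /=.
by apply: eq_bigr => i _; rewrite subSS subKn 1?mulrC// -ltnS.
Qed.

Lemma fps_mul1 a : fps_mul fps_one a = a.
Proof.
apply/funext => n; rewrite /fps_mul big_ord_recl subn0 mul1r big1 ?addr0//.
by move=> i _; rewrite /fps_one mul0r.
Qed.

Lemma fps_exp_mulS b c k :
  fps_mul (fps_exp b k.+1) c = fps_mul b (fps_mul (fps_exp b k) c).
Proof. by rewrite fps_mulA. Qed.

Lemma fps_exp_mul_low b c k n : b 0%N = 0 -> (n < k)%N ->
  fps_mul (fps_exp b k) c n = 0.
Proof.
move=> b0 nk; rewrite /fps_mul big1// => i _.
by rewrite fps_exp_low ?mul0r// (leq_ltn_trans _ nk)// -ltnS.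
Qed.

(** Exchanging the two sums leaves an inner range k <= i. It may be enlarged to k <= n because b^k
    has no coefficient of degree i < k. *)
Lemma fps_comp_mul a b c n : b 0%N = 0 ->
  fps_mul (fps_comp a b) c n =
  \sum_(k < n.+1) a k * fps_mul (fps_exp b k) c n.
Proof.
move=> b0.
under [RHS]eq_bigr do rewrite /fps_mul mulr_sumr.
rewrite exchange_big /=; apply: eq_bigr => i _.
rewrite /fps_comp mulr_suml (big_ord_widen n.+1
  (fun k => a k * fps_exp b k i * c (n - i)%N)) ?ltn_ord//.
rewrite big_mkcond /=; apply: eq_bigr => k _; rewrite -mulrA.
case: ltnP => // ik.
by rewrite (fps_exp_low b0) ?mul0r ?mulr0.
Qed.

End power_series.

(** * Linear maps given as plain functions *)

Section linear_maps.
Context {F : pzRingType} {U V : lmodType F}.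
Variable T : U -> V.
Hypothesis linT : linear T.

Lemma linear_map0 : T 0 = 0.
Proof.
by have := linT (-1) 0 0; rewrite scaler0 addr0 scaleN1r addNr.
Qed.

Lemma linear_mapZ c x : T (c *: x) = c *: T x.
Proof. by have := linT c x 0; rewrite !addr0 linear_map0 addr0. Qed.

Lemma linear_mapD x y : T (x + y) = T x + T y.
Proof. by have := linT 1 x y; rewrite !scale1r. Qed.

Lemma linear_map_sum I (r : seq I) (x : I -> U) :
  T (\sum_(i <- r) x i) = \sum_(i <- r) T (x i).
Proof. exact: (big_morph T linear_mapD linear_map0). Qed.

End linear_maps.

(** * Inner products with a unit vector *)

Section inner_product.
Context {R : realType} {V : hilbertType R}.
Implicit Types x y : V.

Lemma inner_sym0 x y : inner x y = 0 -> inner y x = 0.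
Proof. by move=> xy; rewrite hermC /= xy conjC0 mulr0. Qed.

Lemma inner_unit x : `|x| = 1 -> inner x x = 1.
Proof. by move=> x1; rewrite inner_norm x1 expr1n. Qed.

Lemma inner_sub_proj x y : `|y| = 1 -> inner (x - inner x y *: y) y = 0.
Proof. by move=> y1; rewrite linearBl linearZl_LR /= inner_unit// mulr1 subrr. Qed.

End inner_product.

(** * The orthonormal vectors omega (x) eta^(x)n and the operators on them *)

Section fock_space.
Context {R : realType} {H K : hilbertType R} {S : fock_model H K}.
Variables (omega : H) (eta : K).
Hypotheses (norm_omega : `|omega| = 1) (norm_eta : `|eta| = 1).

Lemma inner_tens h h' (t t' : TK S) :
  inner (tens h t) (tens h' t') = inner h h' * inner t t'.
Proof.
have [_ isom2 _ _] := E_sum S; have [_ _ HTP _] := HT_tensorP S.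
by rewrite isom2.2 HTP.
Qed.

Lemma inner_in1_tens h h' (t : TK S) : inner (E_in1 S h) (tens h' t) = 0.
Proof. by have [_ _ + _] := E_sum S; apply. Qed.

Lemma tens_linear (t : TK S) : linear (fun h => tens h t).
Proof.
move=> c h h'; have [_ [lin2 _] _ _] := E_sum S; have [linl _ _ _] := HT_tensorP S.
by rewrite /tens linl lin2.
Qed.

Lemma inner_tpow n : inner (tpow S eta n) (tpow S eta n) = 1.
Proof.
elim: n => [|n IH] /=; first by rewrite (Kpow1_isom S).1.2 inner_unit.
by have [_ _ -> _] := Kpow_tensorP S n; rewrite IH mulr1 inner_unit.
Qed.

(** Here n is the true tensor degree, with the vacuum in degree 0, whereas [tpow] is shifted by
    one. *)
Definition eta_pow n : TK S := if n is m.+1 then fock (tpow S eta m) else omega1 S.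

Definition omega_eta n : E S := tens omega (eta_pow n).

Lemma inner_eta_pow m n : inner (eta_pow m) (eta_pow n) = (m == n)%:R.
Proof.
have [_ isom] := T_in_isom S; have [isom0 orth _] := T0_sum S.
case: m n => [|m] [|n] /=; first by rewrite inner_unit ?omega1_unit.
- exact: omega1_T_in.
- exact/inner_sym0/omega1_T_in.
rewrite /fock isom eqSS; have [<-|mn] := eqVneq m n; last exact: orth.
by rewrite (isom0 m).2 inner_tpow.
Qed.

Lemma inner_tens_omega_eta h m n :
  inner (tens h (eta_pow m)) (omega_eta n) = inner h omega * (m == n)%:R.
Proof. by rewrite inner_tens inner_eta_pow. Qed.

Lemma norm_omega_eta n : `|omega_eta n| = 1.
Proof.
apply/eqP; rewrite -(@pexpr_eq1 _ _ 2)// -inner_norm inner_tens_omega_eta.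
by rewrite inner_unit// eqxx mulr1.
Qed.

(** One rank-one formula covers both cases of [is_A]. For n = 0, orthogonality of x - T x to Omega
    fixes the scalar; for n > 0, x minus its component along the unit vector [omega_eta n] is
    killed. *)
Lemma is_AE n T x : is_A omega eta n T ->
  T x = inner x (omega_eta n) *: Omega S omega.
Proof.
case: n => [|n] [[linT _]].
  move=> /(_ x)[[c Tx] /(_ (Omega S omega))].
  have /[swap]/[apply] : exists c, Omega S omega = c *: Omega S omega.
    by exists 1; rewrite scale1r.
  rewrite Tx linearBl linearZl_LR /= -[(Omega S omega)]/(omega_eta 0).
  by rewrite inner_unit ?norm_omega_eta// mulr1 => /subr0_eq ->.
move=> [TE T0]; have {}TE : T (omega_eta n.+1) = Omega S omega := TE.
rewrite -{1}(subrK (inner x (omega_eta n.+1) *: omega_eta n.+1) x).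
rewrite (linear_mapD linT) (linear_mapZ linT) TE T0 ?add0r//.
by rewrite inner_sub_proj ?norm_omega_eta.
Qed.

(** Only the component of h along omega survives. *)
Lemma is_Astar_tens T h n : is_Astar omega eta T ->
  T (tens h (eta_pow n)) = inner h omega *: omega_eta n.+1.
Proof.
move=> [[linT _] _ T0 T1 T2].
rewrite -{1}(subrK (inner h omega *: omega) h) (linear_mapD (tens_linear _)).
rewrite (linear_mapD linT) T0 ?inner_sub_proj// add0r.
rewrite (linear_mapZ (tens_linear _)).
by rewrite (linear_mapZ linT); case: n => [|n]; rewrite /eta_pow ?T1 ?T2.
Qed.

End fock_space.

(** * The action of [beta] and its moments *)

Section beta_moments.
Context {R : realType} {H K : hilbertType R} {S : fock_model H K}.
Variables (omega : H) (eta : K) (a : H -> H) (d Astar : E S -> E S).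
Variables (A : nat -> E S -> E S) (f : {poly R[i]}).
Hypotheses (norm_omega : `|omega| = 1) (norm_eta : `|eta| = 1).
Hypotheses (bounded_a : bounded_operator a) (dP : is_pi a d).
Hypothesis AstarP : is_Astar omega eta Astar.
Hypothesis AP : forall n, is_A omega eta n (A n).

Let lina : linear a := bounded_a.1.
Let Af (x : E S) : E S := \sum_(k < size f) f`_k *: A k x.
Let beta (x : E S) : E S := d x + d (Astar x) + Af x.
Local Notation ep := (eta_pow (S := S) eta).
Local Notation Om := (Omega S omega).

Let AfE x :
  Af x = (\sum_(k < size f) f`_k * inner x (omega_eta omega eta k)) *: Om.
Proof.
rewrite /Af scaler_suml; apply: eq_bigr => k _.
by rewrite (is_AE norm_omega norm_eta _ (AP k)) scalerA.
Qed.

Let lind : linear d. Proof. by case: dP => -[]. Qed.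

Let Af_tens h n : Af (tens h (ep n)) = (f`_n * inner h omega) *: Om.
Proof.
rewrite AfE; congr (_ *: _).
under eq_bigr => k _ do rewrite inner_tens_omega_eta// (mulrCA f`_k).
rewrite -mulr_sumr mulrC; congr (_ * _).
have [nf|fn] := ltnP n (size f); last first.
  (* Beyond the size of f the default coefficient is 0, and no index k of the sum equals n. *)
  rewrite nth_default// big1// => k _.
  by rewrite gtn_eqF ?mulr0// (leq_trans (ltn_ord k)).
rewrite (bigD1 (Ordinal nf))//= eqxx mulr1 big1 ?addr0// => k kn.
by rewrite -[n]/(val (Ordinal nf)) val_eqE eq_sym (negbTE kn) mulr0.
Qed.

Let beta_linear : linear beta.
Proof.
have [[linA _] _ _ _ _] := AstarP.
move=> c x y; rewrite /beta linA !lind !AfE.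
under eq_bigr do rewrite linearDl linearZl_LR /= mulrDr mulrCA.
rewrite big_split/= -mulr_sumr scalerDl -scalerA !scalerDr.
by rewrite [X in X + _ = _]addrACA [LHS]addrACA.
Qed.

Let d_tens h n : d (tens h (ep n.+1)) = tens (a h) (ep n.+1).
Proof. by have [_ _ + _] := dP; apply. Qed.

Let AstarE h n := is_Astar_tens norm_omega h n AstarP.

Lemma beta_in1 h : beta (E_in1 S h) = E_in1 S (a h).
Proof.
have [_ A0 _ _ _] := AstarP; have [_ d1 _ _] := dP.
rewrite /beta d1 A0 (linear_map0 lind) addr0 AfE big1 ?scale0r ?addr0// => k _.
by rewrite inner_in1_tens mulr0.
Qed.

Lemma beta_Omega :
  beta Om = f`_0 *: Om + tens (a omega) (ep 1).
Proof.
have [_ _ _ d0] := dP.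
rewrite -{1}[Om]/(tens omega (ep 0)) /beta d0 add0r Af_tens AstarE.
rewrite (linear_mapZ lind) d_tens.
by rewrite inner_unit// mulr1 scale1r addrC.
Qed.

Lemma beta_tens h n : beta (tens h (ep n.+1)) = tens (a h) (ep n.+1) +
  inner h omega *: (f`_n.+1 *: Om + tens (a omega) (ep n.+2)).
Proof.
rewrite /beta Af_tens AstarE (linear_mapZ lind) !d_tens.
by rewrite scalerDr scalerA [inner _ _ * _]mulrC -addrA [_ *: tens _ _ + _]addrC.
Qed.

Let m := moment_series (psi omega) beta.
Let c := fps_add fps_one (moment_series (phi omega) beta).
Let s j := fps_mul (fps_exp m j) c.

Let m0 : m 0%N = 0. Proof. by []. Qed.

Let mE n : (0 < n)%N -> m n = inner (iter n a omega) omega.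
Proof.
case: n => // n _; rewrite /m /moment_series /psi.
have -> : iter n.+1 beta (E_in1 S omega) = E_in1 S (iter n.+1 a omega).
  by elim: n.+1 => // k IH; rewrite !iterS IH beta_in1.
by have [isom1 _ _ _] := E_sum S; rewrite isom1.2.
Qed.

Let cE n : c n = inner (iter n beta Om) Om.
Proof.
case: n => [|n]; last by rewrite /c /fps_add /fps_one add0r.
rewrite /c /fps_add /fps_one addr0 inner_unit//.
exact: (norm_omega_eta (S := S) norm_omega norm_eta 0).
Qed.

(** Closed solution of the recursion for the components, starting from 0 at n = 0. *)
Let h n j : H := \sum_(i < n) s j i *: iter (n - i) a omega.

(** Pairing with omega turns a^(n-i) omega into m_(n-i), which gives the convolution of m with s_j;
    its missing term i = n carries the factor m_0 = 0. *)
Let inner_h n j : inner (h n j) omega = s j.+1 n.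
Proof.
rewrite /s fps_exp_mulS fps_mulC /fps_mul big_ord_recr /= subnn m0 mulr0 addr0.
rewrite linear_sumlz; apply: eq_bigr => i _.
by rewrite linearZl_LR /= mE// subn_gt0.
Qed.

Let hS n j : h n.+1 j = a (h n j) + s j n *: a omega.
Proof.
rewrite /h big_ord_recr /= subSnn (linear_map_sum lina); congr (_ + _).
apply: eq_bigr => i _.
by rewrite (linear_mapZ lina) -iterS subSn// ltnW.
Qed.

(** The series m^n (1 + M) starts in degree n at the earliest. *)
Let h_diag n : h n n = 0.
Proof. by rewrite /h big1// => i _; rewrite /s fps_exp_mul_low// scale0r. Qed.

Let s0 n : s 0 n = c n. Proof. by rewrite /s fps_mul1. Qed.

(** The Omega-coefficient is left as the sum that the computation yields; pairing with Omega
    identifies it with c_(n+1) afterwards. *)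
Let iter_betaS n :
  iter n beta Om = c n *: Om + \sum_(j < n) tens (h n j) (ep j.+1) ->
  iter n.+1 beta Om =
    (\sum_(j < n.+1) f`_j * s j n) *: Om +
    \sum_(j < n.+1) tens (h n.+1 j) (ep j.+1).
Proof.
have tensD g g' t : tens (S := S) (g + g') t = tens g t + tens g' t.
  by rewrite (linear_mapD (tens_linear t)).
have tensZ k g t : tens (S := S) (k *: g) t = k *: tens g t.
  by rewrite (linear_mapZ (tens_linear t)).
move=> IH.
(* By the recursion for h; the summand j = n of the first part drops out since [h n n] vanishes. *)
have -> : \sum_(j < n.+1) tens (h n.+1 j) (ep j.+1) =
    \sum_(j < n) tens (a (h n j)) (ep j.+1) +
    \sum_(j < n.+1) s j n *: tens (a omega) (ep j.+1).
  under eq_bigr do rewrite hS tensD tensZ.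
  rewrite big_split/=; congr (_ + _).
  rewrite big_ord_recr/= h_diag (linear_map0 lina).
  by rewrite (linear_map0 (tens_linear _)) addr0.
rewrite iterS IH (linear_mapD beta_linear) (linear_mapZ beta_linear).
rewrite (linear_map_sum beta_linear) beta_Omega.
under eq_bigr do rewrite beta_tens inner_h scalerDr scalerA mulrC.
(* The terms j = 0 come from [beta Om], where s_0 = c; those of index j + 1 come from the component
   j. *)
rewrite !big_split/= -scaler_suml !big_ord_recl/= !s0.
rewrite scalerDr scalerA [c n * _]mulrC scalerDl.
rewrite -!addrA; congr (_ + _).
by rewrite [LHS]addrCA [RHS]addrCA; congr (_ + _); rewrite addrCA.
Qed.

(** Omega is a unit vector orthogonal to all tensors of positive degree. *)
Let c_Omega n x (y : nat -> H) :
  iter n beta Om = x *: Om + \sum_(j < n) tens (y j) (ep j.+1) -> c n = x.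
Proof.
move=> nE; rewrite cE nE linearDl linearZl_LR linear_sumlz big1 => [|j _].
  by rewrite /= (inner_unit (norm_omega_eta norm_omega norm_eta 0)) mulr1 addr0.
have /= -> := inner_tens_omega_eta (S := S) omega norm_eta (y j) j.+1 0.
by rewrite mulr0.
Qed.

Lemma iter_beta_Omega n :
  iter n beta Om = c n *: Om + \sum_(j < n) tens (h n j) (ep j.+1).
Proof.
elim: n => [|n /iter_betaS nE]; last by rewrite (c_Omega nE).
by rewrite big_ord0 addr0 /c /fps_add addr0 scale1r.
Qed.

Lemma phi_momentS n : c n.+1 = \sum_(j < n.+1) f`_j * s j n.
Proof. exact/c_Omega/iter_betaS/iter_beta_Omega. Qed.

Lemma beta_cT_equation : cT_equation (phi omega) (psi omega) beta (fun k => f`_k).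
Proof.
apply/funext => n; rewrite fps_comp_mul//.
(* The added 0 is the coefficient of degree n + 1 of the series 1, which turns the right side into
   c_(n+1). *)
by rewrite /fps_divz -[RHS]add0r; exact/esym/phi_momentS.
Qed.

Lemma psi_beta : psi omega beta = psi omega d.
Proof. by have [_ d1 _ _] := dP; rewrite /psi beta_in1 d1. Qed.

End beta_moments.

Theorem theorem3p2 (R : realType) (H K : hilbertType R) (S : fock_model H K)
    (omega : H) (eta : K) (d Astar : E S -> E S) (A : nat -> E S -> E S)
    (f : {poly R[i]}) :
  `|omega| = 1 -> `|eta| = 1 ->
  (exists2 a : H -> H, bounded_operator a & is_pi a d) ->
  is_Astar omega eta Astar ->
  (forall n, is_A omega eta n (A n)) ->
  psi omega d != 0 -> f`_0 != 0 ->
  let Af : E S -> E S := fun x => \sum_(k < size f) f`_k *: A k x in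
  let beta : E S -> E S := fun x => d x + d (Astar x) + Af x in
  psi omega beta != 0 /\
  cT (phi omega) (psi omega) beta = (fun k => f`_k).
Proof.
move=> omega1 eta1 [a aB dP] AstarP AP psid f0 Af beta.
have psib : psi omega beta != 0 by rewrite (psi_beta f omega1 eta1 dP AstarP AP).
split=> //; apply/esym/cT_unique => //.
exact: (beta_cT_equation f omega1 eta1 aB dP AstarP AP).
Qed.
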